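(* Let $p\ge1$ and let $\Theta$ be a $p\times p$ real symmetric positive semidefinite matrix with $\Theta_{ij}\le0$ for all $i\ne j$. Then $$\|\Theta\|_1:=\sum_{i,j=1}^p|\Theta_{ij}|\le2\,\mathrm{tr}(\Theta).$$ *)

(* Defs.v *)
From HB Require Import structures.
From mathcomp Require Import all_boot all_order all_algebra.
From mathcomp Require Import sesquilinear reals.

Set Implicit Arguments.
Unset Strict Implicit.
Unset Printing Implicit Defensive.

Import Order.TTheory GRing.Theory Num.Theory.
Local Open Scope ring_scope.

(* Nonnegativity of the quadratic form only: symmetry is a separate hypothesis. *)
Definition posSemidefMx (R : realType) (p : nat) (A : 'M[R]_p) : Prop :=
  forall x : 'cV[R]_p, 0 <= (x^T *m A *m x) 0 0.

(* The entrywise l1 norm, not the operator norm induced by the l1 vector norm. *)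
Definition entry_norm1 (R : realType) (p : nat) (A : 'M[R]_p) : R :=
  \sum_(i < p) \sum_(j < p) `|A i j|.

(* Main.v *)
(* Entrywise, |Theta_ij| = 2 delta_ij Theta_ii - Theta_ij, the diagonal being
   nonnegative. Summing, the norm is 2 tr Theta - 1^T Theta 1, where 1 is the
   all-ones vector, and 1^T Theta 1 >= 0. *)
Require Import Defs.
From mathcomp Require Import all_boot all_order all_algebra.
From mathcomp Require Import sesquilinear reals.

Import Order.TTheory GRing.Theory Num.Theory.
Local Open Scope ring_scope.

(** The quadratic form at the [i]-th standard basis vector is [A i i]. *)
Lemma posSemidefMx_diag_ge0 (R : realType) (p : nat) (A : 'M[R]_p) (i : 'I_p) :
  posSemidefMx A -> 0 <= A i i.
Proof.
move=> /(_ (delta_mx i 0)).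
by rewrite trmx_delta -rowE -colE !mxE.
Qed.

Lemma posSemidefMx_sum_ge0 (R : realType) (p : nat) (A : 'M[R]_p) :
  posSemidefMx A -> 0 <= \sum_i \sum_j A i j.
Proof.
(* Expanding the matrix product puts the column index outermost, so the double sum is swapped to
   match. *)
move=> /(_ (const_mx 1)); rewrite mxE exchange_big /=.
congr (0 <= _); apply: eq_bigr => j _.
by rewrite !mxE mulr1; apply: eq_bigr => i _; rewrite !mxE mul1r.
Qed.

Theorem lemma9 (R : realType) (p : nat) (hp : (1 <= p)%N) (Theta : 'M[R]_p)
    (Theta_sym : Theta \is symmetricmx)
    (Theta_psd : posSemidefMx Theta)
    (Theta_offdiag : forall i j : 'I_p, i != j -> Theta i j <= 0) :
  entry_norm1 Theta <= 2 * \tr Theta.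
Proof.
suff -> : entry_norm1 Theta = 2 * \tr Theta - \sum_i \sum_j Theta i j.
  by rewrite gerBl posSemidefMx_sum_ge0.
(* The identity already holds in each row [i]: the diagonal term gives [2 * Theta i i - Theta i i],
   and every other entry only changes sign. *)
rewrite mulr_sumr -sumrB; apply: eq_bigr => i _.
rewrite (bigD1 i) //= [in RHS](bigD1 i) //= ger0_norm ?posSemidefMx_diag_ge0 //.
rewrite opprD addrA mulr2n mulrDl mul1r addrK -sumrN; congr (_ + _).
by apply: eq_bigr => j ji; rewrite ler0_norm // Theta_offdiag // eq_sym.
Qed.
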